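(* Let $m>n\ge1$ be relatively prime integers, $\kappa>0$, and $$\Delta^U_{n,m}(\kappa)=\{(x_1,x_2)\in\mathbb R^2: x_1\ge0,\ x_2\ge0,\ -nx_1+mx_2+\kappa>0\}.$$ The following points $x\in\mathrm{Int}\,\Delta^U_{n,m}(\kappa)$ can be displaced by probes based on the facet $\{x_1=0\}$: (a) points in $\{x_1<x_2\}$, by probes with direction $(1,1)$; (b) points in $\{x_1<\tfrac{m}{2n}x_2+\tfrac{\kappa}{2n}\}$, by probes with direction $(1,0)$. The following points $x\in\mathrm{Int}\,\Delta^U_{n,m}(\kappa)$ can be displaced by probes based on the facet $\{x_2=0\}$: for each $c=0,1,\dots,\lceil m/n\rceil-1$, (c) points in $\{cx_2<x_1<cx_2+\kappa/n\}$, by probes with direction $(c,1)$.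
   Context: $\Delta=\Delta^U_{n,m}(\kappa)$ is the image of the open set $U_{n,m}(\kappa)=\{z\in\mathbb C^2:-n|z_1|^2+m|z_2|^2+\kappa>0\}$, with symplectic form $\omega_0=\frac1\pi\sum dx_k\wedge dy_k$, under the moment map $\Phi_0(z)=(|z_1|^2,|z_2|^2)$. Its facets are those in $\{x_1=0\}$ and $\{x_2=0\}$, with primitive interior conormals $(1,0)$ and $(0,1)$; the slanted boundary is not part of $\Delta$. A probe $P$ in $\Delta$ is a directed line segment contained in $\Delta$ starting at a point $b_P$ in the interior of a facet $F_P$ (''based on $F_P$''), with primitive direction $v_P\in\mathbb Z^2$ satisfying $\langle\eta_{F_P},v_P\rangle=1$ where $\eta_{F_P}$ is the primitive interior conormal of $F_P$, and ending at $b_P+\ell(P)v_P$; $\ell(P)$ is its length. A point $u\in\mathrm{Int}\,\Delta$ can be displaced by $P$ if $u=b_P+tv_P\in P$ with $t<\tfrac12\ell(P)$ (less than halfway along $P$); the Lagrangian fiber over $u$ is then displaceable by a compactly supported Hamiltonian diffeomorphism. *)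

(* Defs.v *)
From HB Require Import structures.
From mathcomp Require Import all_boot all_order all_algebra.
From mathcomp Require Import all_classical all_reals all_analysis.

Set Implicit Arguments.
Unset Strict Implicit.
Unset Printing Implicit Defensive.

Import Order.TTheory GRing.Theory Num.Theory.
Import numFieldNormedType.Exports.

Local Open Scope classical_set_scope.
Local Open Scope ring_scope.

Definition pairing (T : pzRingType) (a b : T * T) : T := a.1 * b.1 + a.2 * b.2.

Definition intvec (R : pzRingType) (v : int * int) : R * R :=
  (v.1%:~R, v.2%:~R).

Definition primitive (v : int * int) : bool := coprimez v.1 v.2.

Definition hyperplane (R : realType) (eta : int * int) (a : R) : set (R * R) :=
  [set x | pairing (intvec R eta) x = a].

Definition relint (R : realType) (H F : set (R * R)) : set (R * R) :=
  [set x | F x /\ \forall y \near x, H y -> F y].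

(* [F] is the facet of [D] on the line <eta, x> = a and [eta] is its primitive
   interior conormal.  Nonemptiness of the relative interior excludes vertices,
   so [F] determines [eta] and [a]. *)
Definition facet_conormal (R : realType) (D F : set (R * R))
    (eta : int * int) (a : R) : Prop :=
  [/\ primitive eta,
      D `<=` [set x | a <= pairing (intvec R eta) x],
      F = D `&` hyperplane eta a &
      relint (hyperplane eta a) F !=set0].

Record probe (R : realType) := Probe {
  probe_base : R * R;
  probe_dir : int * int;
  probe_len : R   (* measured in units of [probe_dir] *)
}.

Definition probe_point (R : realType) (P : probe R) (t : R) : R * R :=
  ((probe_base P).1 + t * (intvec R (probe_dir P)).1,
   (probe_base P).2 + t * (intvec R (probe_dir P)).2).

(* The segment is closed: its end point must also lie in [D]. *)
Definition is_probe (R : realType) (D F : set (R * R)) (P : probe R) : Prop :=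
  exists eta a,
    [/\ facet_conormal D F eta a,
        relint (hyperplane eta a) F (probe_base P),
        primitive (probe_dir P),
        pairing eta (probe_dir P) = 1 &
        0 < probe_len P /\
        forall t, 0 <= t <= probe_len P -> D (probe_point P t)].

Definition displaces (R : realType) (D : set (R * R)) (P : probe R)
    (u : R * R) : Prop :=
  interior D u /\
  exists t, [/\ 0 <= t, t < probe_len P / 2 & u = probe_point P t].

Definition displaced_by_probe (R : realType) (D F : set (R * R))
    (v : int * int) (u : R * R) : Prop :=
  exists P : probe R, [/\ is_probe D F P, probe_dir P = v & displaces D P u].

Definition DeltaU (R : realType) (n m : nat) (kappa : R) : set (R * R) :=
  [set x | [/\ 0 <= x.1, 0 <= x.2 & 0 < - (n%:R * x.1) + m%:R * x.2 + kappa]].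

Definition facet1 (R : realType) (n m : nat) (kappa : R) : set (R * R) :=
  DeltaU n m kappa `&` [set x | x.1 = 0].

Definition facet2 (R : realType) (n m : nat) (kappa : R) : set (R * R) :=
  DeltaU n m kappa `&` [set x | x.2 = 0].

(* Main.v *)
Require Import Defs.
From HB Require Import structures.
From mathcomp Require Import all_boot all_order all_algebra.
From mathcomp Require Import all_classical all_reals all_analysis.
From mathcomp Require Import ring lra.

(** Write [slack x = - n x1 + m x2 + kappa], so that the region is the part of
    the first quadrant where the slack is positive.  Running backwards from [x]
    along the prescribed direction until a coordinate vanishes gives the base
    of the probe, and the time [t] needed to come back is the coordinate that
    was killed: [t = x1] for the facet on the x2-axis, [t = x2] for the other
    one.  It remains to prolong the segment to some length exceeding [2 t]
    without leaving the region.

    The slack changes at the constant rate [- n v1 + m v2] along the direction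
    [v].  For [v = (1, 1)] the rate [m - n] is positive, and for [v = (c, 1)]
    the rate [m - n c] is positive because [c <= ceil (m / n) - 1] means
    [c < m / n]; in both cases the region contains the whole ray, and the
    hypothesis on [x] only says that the base is interior to the facet.  For
    [v = (1, 0)] the slack decreases and vanishes at time [(m x2 + kappa) / n];
    the hypothesis says that this exceeds [2 x1], which leaves room for an
    admissible length.

    The topological content is small: the base is interior to its facet
    because the other two inequalities hold strictly there, hence nearby
    ([facet1_relint], [facet2_relint]), and a point interior to the region is
    strictly above the x1-axis ([interior_DeltaU_snd_gt0]). *)


Set Implicit Arguments.
Unset Strict Implicit.
Unset Printing Implicit Defensive.

Import Order.TTheory GRing.Theory Num.Theory.
Import numFieldNormedType.Exports.

Local Open Scope classical_set_scope.
Local Open Scope ring_scope.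

(** The existence of one interior base point already makes the relative
    interior of the facet nonempty, so it settles both conditions of that kind
    in the notion of probe. *)
Lemma displaced_from_base (R : realType) (D F : set (R * R))
    (eta v : int * int) (a : R) (b u : R * R) (t l : R) :
  primitive eta -> D `<=` [set x | a <= pairing (intvec R eta) x] ->
  F = D `&` hyperplane eta a -> relint (hyperplane eta a) F b ->
  primitive v -> pairing eta v = 1 ->
  (forall s, 0 <= s <= l -> D (probe_point (Probe b v l) s)) ->
  interior D u -> 0 <= t -> t < l / 2 -> u = probe_point (Probe b v l) t ->
  displaced_by_probe D F v u.
Proof.
move=> eta_prim D_half F_eq b_int v_prim eta_v D_seg u_int t_ge0 t_lt u_eq.
exists (Probe b v l); split=> //; last by split=> //; exists t.
exists eta, a; split=> //; first by split=> //; exists b.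
by split=> //=; lra.
Qed.

Lemma near_slack_gt0 (R : realType) (n m : nat) (kappa : R) (b : R * R) :
  0 < - (n%:R * b.1) + m%:R * b.2 + kappa ->
  \forall y \near b, 0 < - (n%:R * y.1) + m%:R * y.2 + kappa.
Proof.
have slack_cvg : - (n%:R * y.1) + m%:R * y.2 + kappa @[y --> b]
    --> - (n%:R * b.1) + m%:R * b.2 + kappa.
  apply: cvgD; last exact: cvg_cst.
  apply: cvgD; first apply: cvgN.
    by apply: cvgM; [exact: cvg_cst|exact: cvg_fst].
  by apply: cvgM; [exact: cvg_cst|exact: cvg_snd].
by move=> b_slack; exact: (cvgr_gt _ slack_cvg).
Qed.

Lemma hyperplane10 (R : realType) (x : R * R) :
  hyperplane (1, 0) 0 x <-> x.1 = 0.
Proof. by rewrite /hyperplane /pairing /= mul1r mul0r addr0. Qed.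

Lemma hyperplane01 (R : realType) (x : R * R) :
  hyperplane (0, 1) 0 x <-> x.2 = 0.
Proof. by rewrite /hyperplane /pairing /= mul1r mul0r add0r. Qed.

Lemma facet1_relint (R : realType) (n m : nat) (kappa : R) (b : R * R) :
  b.1 = 0 -> 0 < b.2 -> 0 < - (n%:R * b.1) + m%:R * b.2 + kappa ->
  relint (hyperplane (1, 0) 0) (facet1 n m kappa) b.
Proof.
move=> b1 b2 b_slack; split; first by split=> //; split=> //; lra.
have b2_cvg : y.2 @[y --> b] --> b.2 by exact: cvg_snd.
have b2_near : \forall y \near b, 0 < y.2 by exact: (cvgr_gt _ b2_cvg).
near=> y => /hyperplane10 y1; split=> //; split; first by rewrite y1.
- by apply: ltW; near: y.
- by near: y; exact: near_slack_gt0.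
Unshelve. all: by end_near. Qed.

Lemma facet2_relint (R : realType) (n m : nat) (kappa : R) (b : R * R) :
  0 < b.1 -> b.2 = 0 -> 0 < - (n%:R * b.1) + m%:R * b.2 + kappa ->
  relint (hyperplane (0, 1) 0) (facet2 n m kappa) b.
Proof.
move=> b1 b2 b_slack; split; first by split=> //; split=> //; lra.
have b1_cvg : y.1 @[y --> b] --> b.1 by exact: cvg_fst.
have b1_near : \forall y \near b, 0 < y.1 by exact: (cvgr_gt _ b1_cvg).
near=> y => /hyperplane01 y2; split=> //; split.
- by apply: ltW; near: y.
- by rewrite y2.
- by near: y; exact: near_slack_gt0.
Unshelve. all: by end_near. Qed.

Lemma displaced_from_facet1 (R : realType) (n m : nat) (kappa : R)
    (v : int * int) (b u : R * R) (t l : R) :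
  b.1 = 0 -> 0 < b.2 -> primitive v -> v.1 = 1 ->
  (forall s, 0 <= s <= l ->
    DeltaU n m kappa (probe_point (Probe b v l) s)) ->
  interior (DeltaU n m kappa) u -> 0 <= t -> t < l / 2 ->
  u = probe_point (Probe b v l) t ->
  displaced_by_probe (DeltaU n m kappa) (facet1 n m kappa) v u.
Proof.
move=> b1 b2 v_prim v1 D_seg u_int t_ge0 t_lt u_eq.
have [_ _] : DeltaU n m kappa (probe_point (Probe b v l) 0).
  by apply: D_seg; lra.
rewrite /probe_point /= !mul0r !addr0 => b_slack.
apply: (@displaced_from_base _ _ _ (1, 0) _ 0 b _ t l) => //.
- by move=> x [x1 _ _]; rewrite /= /pairing /= mul1r mul0r addr0.
- by apply/seteqP; split=> x [xD] /hyperplane10.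
- exact: facet1_relint.
- by rewrite /pairing v1 mul1r mul0r addr0.
Qed.

Lemma displaced_from_facet2 (R : realType) (n m : nat) (kappa : R)
    (v : int * int) (b u : R * R) (t l : R) :
  0 < b.1 -> b.2 = 0 -> primitive v -> v.2 = 1 ->
  (forall s, 0 <= s <= l ->
    DeltaU n m kappa (probe_point (Probe b v l) s)) ->
  interior (DeltaU n m kappa) u -> 0 <= t -> t < l / 2 ->
  u = probe_point (Probe b v l) t ->
  displaced_by_probe (DeltaU n m kappa) (facet2 n m kappa) v u.
Proof.
move=> b1 b2 v_prim v2 D_seg u_int t_ge0 t_lt u_eq.
have [_ _] : DeltaU n m kappa (probe_point (Probe b v l) 0).
  by apply: D_seg; lra.
rewrite /probe_point /= !mul0r !addr0 => b_slack.
apply: (@displaced_from_base _ _ _ (0, 1) _ 0 b _ t l) => //.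
- by move=> x [_ x2 _]; rewrite /= /pairing /= mul1r mul0r add0r.
- by apply/seteqP; split=> x [xD] /hyperplane01.
- exact: facet2_relint.
- by rewrite /pairing v2 mul1r mul0r add0r.
Qed.

(** A point of the region on the x1-axis has points with negative second
    coordinate arbitrarily close below it. *)
Lemma interior_DeltaU_snd_gt0 (R : realType) (n m : nat) (kappa : R)
    (x : R * R) :
  interior (DeltaU n m kappa) x -> 0 < x.2.
Proof.
move=> /nbhs_ballP[e /= e_gt0 ball_D].
have [|_ /=] := ball_D (x.1, x.2 - e / 2); last by lra.
split=> /=; first exact: ballxx.
rewrite /ball /= opprB addrC subrK gtr0_norm; lra.
Qed.

Theorem lemma3p2p1 (R : realType) (m n : nat) (kappa : R)
    (n_ge1 : (1 <= n)%N) (n_lt_m : (n < m)%N) (co_mn : coprime m n)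
    (kappa_gt0 : 0 < kappa) :
  forall x : R * R, interior (DeltaU n m kappa) x ->
  [/\ (* (a) *)
      x.1 < x.2 ->
        displaced_by_probe (DeltaU n m kappa) (facet1 n m kappa) (1, 1) x,
      (* (b) *)
      x.1 < m%:R / (2 * n%:R) * x.2 + kappa / (2 * n%:R) ->
        displaced_by_probe (DeltaU n m kappa) (facet1 n m kappa) (1, 0) x &
      (* (c) *)
      forall c : nat, c%:Z <= Num.ceil (m%:R / n%:R : R) - 1 ->
        c%:R * x.2 < x.1 < c%:R * x.2 + kappa / n%:R ->
        displaced_by_probe (DeltaU n m kappa) (facet2 n m kappa) (c%:Z, 1) x].
Proof.
move=> x x_int; have [x1 x2 x_slack] := interior_subset x_int.
have x2_gt0 := interior_DeltaU_snd_gt0 x_int.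
have n_gt0 : 0 < n%:R :> R by rewrite ltr0n.
have n_lt_mR : n%:R < m%:R :> R by rewrite ltr_nat.
split=> [x1_lt|x1_lt|c c_le /andP[cx_lt x_lt]].
- apply: (@displaced_from_facet1 _ _ _ _ _ (0, x.2 - x.1) _ x.1
    (2 * x.1 + 1)) => //=.
  + by rewrite subr_gt0.
  + move=> s /andP[s_ge0 _]; rewrite /probe_point /= mulr1.
    by split=> /=; nra.
  + by lra.
  + by rewrite /probe_point /= mulr1 add0r subrK; case: (x).
- have exit_gt : 2 * x.1 < (m%:R * x.2 + kappa) / n%:R.
    have -> : (m%:R * x.2 + kappa) / n%:R
        = 2 * (m%:R / (2 * n%:R) * x.2 + kappa / (2 * n%:R)) by field; lra.
    by lra.
  (* Any length strictly between [2 x1] and the exit time would do. *)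
  pose l := (2 * x.1 + (m%:R * x.2 + kappa) / n%:R) / 2.
  apply: (@displaced_from_facet1 _ _ _ _ _ (0, x.2) _ x.1 l) => //=.
  + move=> s /andP[s_ge0 s_le]; rewrite /probe_point /= mulr1 mulr0 addr0 add0r.
    split=> //=.
    have : s < (m%:R * x.2 + kappa) / n%:R.
      by apply: le_lt_trans s_le _; rewrite /l; lra.
    by rewrite ltr_pdivlMr// => ?; lra.
  + by rewrite /l; lra.
  + by rewrite /probe_point /= mulr1 mulr0 addr0 add0r; case: (x).
- have nc_lt_m : n%:R * c%:R < m%:R :> R.
    have : c%:~R < m%:R / n%:R :> R by rewrite -ceil_gt_int -lezD1 -lerBrDr.
    by rewrite ltr_pdivlMr// mulrC.
  have {x_lt} base_slack : n%:R * (x.1 - c%:R * x.2) < kappa.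
    by rewrite mulrC -ltr_pdivlMr//; lra.
  apply: (@displaced_from_facet2 _ _ _ _ _ (x.1 - c%:R * x.2, 0) _ x.2
    (2 * x.2 + 1)) => //=.
  + by lra.
  + by rewrite /primitive /= /coprimez gcdz1.
  + move=> s /andP[s_ge0 _]; rewrite /probe_point /= mulr1 add0r.
    have c_ge0 : 0 <= c%:R :> R by exact: ler0n.
    have cs_ge0 : 0 <= s * c%:~R :> R by exact: mulr_ge0.
    split=> //=; first by lra.
    rewrite -pmulrn; nra.
  + by lra.
  + rewrite /probe_point /= mulr1 add0r -pmulrn mulrC subrK.
    by case: (x).
Qed.
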